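(* Let $n\ge 2$. The number of narcissistic preference profiles $(\succ_1,\succ_2,\dots,\succ_n)$ for the voter set $\mathcal{V}=\{1,2,\dots,n\}$ that are single-peaked with respect to the linear order $1\triangleright 2\triangleright\cdots\triangleright n$ is $\prod_{2\le i\le n-1}\binom{n-1}{i-1}$.
   Context: Let $\mathcal{V}=\{1,2,\dots,n\}$ be a set of voters, which is also the set of alternatives. A preference order $\succ$ on $\mathcal{V}$ is a strict linear order on $\mathcal{V}$; $a\succ b$ means $a$ is preferred to $b$. A preference profile for $\mathcal{V}$ is an $n$-tuple $(\succ_1,\dots,\succ_n)$ of preference orders on $\mathcal{V}$, where $\succ_i$ is the preference order of voter $i$. Let $\mathrm{peak}(\succ)$ denote the most preferred alternative in $\succ$. A profile is narcissistic if $\mathrm{peak}(\succ_i)=i$ for every voter $i\in\mathcal{V}$. Given a (strict) linear order $\triangleright$ on $\mathcal{V}$, a preference order $\succ$ is single-peaked with respect to $\triangleright$ if for every two alternatives $a,b\in\mathcal{V}$: if $a\triangleright b\triangleright \mathrm{peak}(\succ)$ or $\mathrm{peak}(\succ)\triangleright b\triangleright a$, then $b\succ a$. A profile is single-peaked with respect to $\triangleright$ if each of its preference orders is. Profiles are counted as $n$-tuples (distinct tuples are distinct profiles); an empty product equals $1$. *)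

(* Defs.v *)
From HB Require Import structures.
From mathcomp Require Import all_boot.

Set Implicit Arguments.
Unset Strict Implicit.
Unset Printing Implicit Defensive.

(* A binary relation on V is encoded as the set of its pairs, so that linear
   orders, and hence profiles, form a finite type and can be counted. *)
Definition strict_linear (V : finType) (R : {set V * V}) : bool :=
  [&& [forall a, (a, a) \notin R],
      [forall a, forall b, forall c,
         ((a, b) \in R) && ((b, c) \in R) ==> ((a, c) \in R)]
    & [forall a, forall b, (a != b) ==> ((a, b) \in R) || ((b, a) \in R)]].

Record linord (V : finType) : Type := LinOrd {
  linord_set : {set V * V};
  linord_setP : strict_linear linord_set
}.

HB.instance Definition _ (V : finType) := [isSub for @linord_set V].
HB.instance Definition _ (V : finType) := [Finite of linord V by <:].

Definition linord_rel (V : finType) (R : linord V) : rel V :=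
  fun a b => (a, b) \in linord_set R.
Coercion linord_rel : linord >-> rel.

(* For a preference order R, [R a b] reads "a is preferred to b". The peak
   fails to exist (None) only when V is empty. *)
Definition peak (V : finType) (R : linord V) : option V :=
  [pick a | [forall b, (b != a) ==> R a b]].

Lemma peakP (V : finType) (R : linord V) (a : V) :
  reflect (forall b, b != a -> R a b) (peak R == Some a).
Proof.
rewrite /peak; case: pickP => [t /'forall_implyP top | none]; last first.
  apply: (iffP idP) => // top.
  by have /negbT/negP[] := none a; apply/'forall_implyP.
apply: (iffP eqP) => [[<-] // | topa].
congr Some; apply/eqP/contraT => ta.
have /and3P[/forallP/(_ a)/negP irr /forallP tr _] := linord_setP R.
case: irr; move: (tr a) => /forallP/(_ t)/forallP/(_ a)/implyP; apply.
by apply/andP; split; [apply: topa | apply: top; rewrite eq_sym].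
Qed.

Lemma peak_exists (V : finType) (R : linord V) (v : V) : peak R != None.
Proof.
have /and3P[/forallP irr /forallP tr /forallP tot] := linord_setP R.
pose d a := #|[set b | R a b]|.
case: (arg_maxnP (P := xpredT) d (i0 := v)) => // t _ tmax.
suff /peakP/eqP -> : forall b, b != t -> R t b by [].
move=> b bt; have /forallP/(_ t)/implyP/(_ bt)/orP[Rbt|//] := tot b.
have := tmax b isT; rewrite /= leqNgt => /negP[].
apply/proper_card/properP; split.
  apply/subsetP => c; rewrite !inE => Rtc.
  move: (tr b) => /forallP/(_ t)/forallP/(_ c)/implyP; apply.
  by apply/andP.
by exists t; rewrite !inE //; apply: irr.
Qed.

Definition single_peaked (V : finType) (L R : linord V) : bool :=
  if peak R is Some t then
    [forall a, forall b,
       ((L a b && L b t) || (L t b && L b a)) ==> R b a]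
  else false.

(* The voters (and alternatives) 1, ..., n are the elements 0, ..., n-1
   of 'I_n. *)
Definition profile (n : nat) : Type := n.-tuple (linord 'I_n).

Definition narcissistic (n : nat) (P : profile n) : bool :=
  [forall i, peak (tnth P i) == Some i].

Definition single_peaked_profile (n : nat) (L : linord 'I_n) (P : profile n)
    : bool :=
  [forall i, single_peaked L (tnth P i)].

Definition lt_pairs (n : nat) : {set 'I_n * 'I_n} :=
  [set p : 'I_n * 'I_n | p.1 < p.2].

Lemma lt_pairs_strict_linear (n : nat) : strict_linear (lt_pairs n).
Proof.
apply/and3P; split.
- by apply/forallP => a; rewrite inE ltnn.
- apply/forallP => a; apply/forallP => b; apply/forallP => c.
  by apply/implyP; rewrite !inE => /andP[]; apply: ltn_trans.
- apply/forallP => a; apply/forallP => b.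
  by apply/implyP; rewrite !inE /= -neq_ltn.
Qed.

Definition natural_order (n : nat) : linord 'I_n :=
  LinOrd (lt_pairs_strict_linear n).

(* Main.v *)
(* Fix the peak i. An order is determined by its rank function, a bijection
   f of 0..n-1 (f x counts the alternatives preferred to x). It has peak i and
   is single-peaked iff f i = 0, f decreases on the left of i and increases on
   its right. Such an f is determined by the set of values it takes on the left
   of i, which can be any i-element subset of the n-1 nonzero ranks. Hence voter
   i has 'C(n-1, i) possible orders, and voters choose independently. *)

Require Import Defs.
From mathcomp Require Import all_boot zify.

Set Implicit Arguments.
Unset Strict Implicit.
Unset Printing Implicit Defensive.

(** Independence of the voters: tuples correspond to finite functions, for which [card_family] gives
    the product. *)
Lemma card_tuple_family (T : finType) (n : nat) (F : 'I_n -> {set T}) :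
  #|[set t : n.-tuple T | [forall i, tnth t i \in F i]]| = \prod_i #|F i|.
Proof.
transitivity #|family F|; last first.
  by rewrite card_family foldrE big_map big_enum.
rewrite -(card_imset _ (f := fun t : n.-tuple T => [ffun i => tnth t i])).
  apply: eq_card => f; apply/imsetP/familyP => [[t] | Ff].
    by rewrite inE => /forallP Ft -> i; rewrite ffunE.
  exists [tuple f i | i < n]; last first.
    by apply/ffunP => i; rewrite ffunE tnth_mktuple.
  by rewrite inE; apply/forallP => i; rewrite tnth_mktuple; apply: Ff.
by move=> t u /ffunP tu; apply: eq_from_tnth => i; have := tu i; rewrite !ffunE.
Qed.

(** * Strict linear orders on a finite type *)

Section LinearOrders.
Variable V : finType.
Implicit Types (R : linord V) (a b c : V).

Lemma linord_irr R a : R a a = false.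
Proof. by have /and3P[/forallP/(_ a)/negbTE] := linord_setP R. Qed.

Lemma linord_trans R b a c : R a b -> R b c -> R a c.
Proof.
move=> Rab Rbc; have /and3P[_ /forallP/(_ a)/forallP/(_ b) tr _] := linord_setP R.
by move/forallP/(_ c)/implyP: tr; apply; apply/andP.
Qed.

Lemma linord_total R a b : a != b -> R a b || R b a.
Proof.
by have /and3P[_ _ /forallP/(_ a)/forallP/(_ b)/implyP] := linord_setP R.
Qed.

Lemma linord_asym R a b : R a b -> R b a = false.
Proof. by move=> Rab; apply/negP => /(linord_trans Rab); rewrite linord_irr. Qed.

Lemma eq_linord R1 R2 : R1 =2 R2 -> R1 = R2.
Proof. by move=> eqR; apply/val_inj/setP => -[a b]; apply: eqR. Qed.

Lemma strict_linear_of_inj (f : V -> nat) :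
  injective f -> strict_linear [set p : V * V | f p.1 < f p.2].
Proof.
move=> f_inj; apply/and3P; split.
- by apply/forallP => a; rewrite inE ltnn.
- apply/forallP => a; apply/forallP => b; apply/forallP => c.
  by apply/implyP; rewrite !inE => /andP[]; apply: ltn_trans.
- apply/forallP => a; apply/forallP => b; apply/implyP.
  by rewrite !inE /= -neq_ltn (inj_eq f_inj).
Qed.

(** If [R a b], transitivity puts everything preferred to [a] among what is preferred to [b], and
    [a] itself makes the inclusion strict. Totality gives the converse. *)
Lemma card_better_lt R a b : (#|[set c | R c a]| < #|[set c | R c b]|) = R a b.
Proof.
have mono x y : R x y -> #|[set c | R c x]| < #|[set c | R c y]|.
  move=> Rxy; apply/proper_card/properP; split.
    by apply/subsetP => c; rewrite !inE => /linord_trans; apply.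
  by exists x; rewrite !inE ?linord_irr.
apply/idP/idP => [|/mono //]; apply: contraTT => nRab; rewrite -leqNgt.
have [->//|/(linord_total R)] := eqVneq a b.
by rewrite (negbTE nRab) => /mono/ltnW.
Qed.

End LinearOrders.

(** * Rank functions of linear orders *)

Section Ranks.
Variable m : nat.
Implicit Types (R : linord 'I_m.+1) (i a b x : 'I_m.+1) (A D : {set 'I_m.+1}).
Implicit Types f g : 'I_m.+1 -> 'I_m.+1.

(** [inord] never falls back on its default: [x] is not preferred to itself, so the count is at most
    [m]. *)
Definition rank R x : 'I_m.+1 := inord #|[set b | R b x]|.

Lemma val_rank R x : rank R x = #|[set b | R b x]| :> nat.
Proof.
rewrite inordK // -[X in _ < X]card_ord -cardsT; apply/proper_card/properP.
by split; [apply: subsetT | exists x; rewrite !inE ?linord_irr].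
Qed.

Lemma rank_lt R a b : (rank R a < rank R b) = R a b.
Proof. by rewrite !val_rank card_better_lt. Qed.

Lemma rank_inj R : injective (rank R).
Proof.
move=> a b eqr; apply/eqP/contraT => /(linord_total R).
by rewrite -!rank_lt eqr ltnn.
Qed.

Lemma card_ord_lt x : #|[set y : 'I_m.+1 | y < x]| = x.
Proof.
have w_inj : injective (widen_ord (ltnW (ltn_ord x))).
  by move=> y z /(congr1 val) yz; apply: val_inj.
rewrite -[RHS]card_ord -(card_imset _ w_inj).
apply: eq_card => y; rewrite inE.
apply/idP/imsetP => [yx | [z _ ->] /=]; last exact: ltn_ord.
by exists (Ordinal yx) => //; apply: val_inj.
Qed.

(** Order the alternatives by [f]. As [f] is a bijection, exactly [f x] alternatives have a value
    below [f x]. *)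
Lemma ex_linord_rank f :
  injective f -> exists R : linord 'I_m.+1, rank R =1 f.
Proof.
move=> f_inj; have vf_inj : injective (fun x => f x : nat).
  by move=> x y /val_inj/f_inj.
pose R := LinOrd (strict_linear_of_inj vf_inj).
have RE a b : R a b = (f a < f b) by rewrite /linord_rel inE.
exists R => // x; apply: val_inj; rewrite /= val_rank -[RHS]card_ord_lt.
rewrite -[RHS](on_card_preimset (f := f)); last exact/onW_bij/injF_bij.
by apply: eq_card => b; rewrite !inE RE.
Qed.

(** * Single-peaked orders as valley-shaped rank functions *)

Definition below i : {set 'I_m.+1} := [set x : 'I_m.+1 | x < i].

Definition valley i f :=
  [/\ f i = ord0, forall a b, a < b -> b < i -> f b < f a
    & forall a b, i < b -> b < a -> f b < f a].

Definition admissible i : {set linord 'I_m.+1} :=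
  [set R : linord 'I_m.+1 |
    (peak R == Some i) && single_peaked (natural_order m.+1) R].

Lemma rank_eq0 R i : (rank R i == ord0) = (peak R == Some i).
Proof.
apply/eqP/peakP => [ri b bi | top].
  rewrite -rank_lt ri lt0n; apply: contra_neq bi => rb.
  by apply: (@rank_inj R); rewrite ri; apply: val_inj.
apply: val_inj; rewrite /= val_rank; apply/eqP; rewrite cards_eq0 -subset0.
apply/subsetP => b; rewrite !inE; have [->|/top/linord_asym->//] := eqVneq b i.
by rewrite linord_irr.
Qed.

(** Since [R b a] means that [b] has the smaller rank, the two cases of single-peakedness at the
    peak [i] are the two monotonicity clauses of [valley]. *)
Lemma admissibleP R i : reflect (valley i (rank R)) (R \in admissible i).
Proof.
have natE a b : natural_order m.+1 a b = (a < b) by rewrite /linord_rel inE.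
rewrite inE -rank_eq0; apply: (iffP andP) => [[/eqP r0] | [r0 lft rgt]].
  have /eqP peakR : peak R == Some i by rewrite -rank_eq0 r0.
  rewrite /single_peaked peakR => /forallP sp.
  split=> // a b ab bi; rewrite rank_lt;
    have /forallP/(_ b)/implyP := sp a; apply; rewrite !natE; lia.
rewrite r0; split=> //; have /eqP peakR : peak R == Some i by rewrite -rank_eq0 r0.
rewrite /single_peaked peakR; apply/forallP => a; apply/forallP => b.
by rewrite !natE -rank_lt; apply/implyP => /orP[] /andP[]; [apply: lft | apply: rgt].
Qed.

Lemma sorted_enum_ord A : sorted (fun a b : 'I_m.+1 => a < b) (enum A).
Proof.
have -> : enum A = filter (mem A) (enum 'I_m.+1).
  by rewrite [in RHS]enumT.
apply: sorted_filter; first by move=> x y z; apply: ltn_trans.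
by have := iota_ltn_sorted 0 m.+1; rewrite -val_enum_ord sorted_map.
Qed.

Lemma eq_in_sorted_image (r : rel 'I_m.+1) D f g :
  transitive r -> irreflexive r ->
  {in D &, forall a b, a < b -> r (f a) (f b)} ->
  {in D &, forall a b, a < b -> r (g a) (g b)} ->
  f @: D = g @: D -> {in D, f =1 g}.
Proof.
move=> r_tr r_irr fD gD eqfg.
have srt h : {in D &, forall a b : 'I_m.+1, a < b -> r (h a) (h b)} ->
    sorted r (map h (enum D)).
  move=> hD; apply: (homo_sorted_in (P := mem D)) (sorted_enum_ord D) => //.
  by apply/allP => x; rewrite mem_enum.
have /eq_in_map eqm : map f (enum D) = map g (enum D).
  apply: irr_sorted_eq (srt f fD) (srt g gD) _ => // y.
  have mE h : (y \in map h (enum D)) = (y \in h @: D).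
    apply/mapP/imsetP => -[x xD ->]; exists x => //; move: xD;
      by rewrite mem_enum.
  by rewrite !mE eqfg.
by move=> x xD; apply: eqm; rewrite mem_enum.
Qed.

(** Left of [i], a decreasing function is determined by its image. The image right of [i] is what
    remains after removing 0 and the left values, so the increasing part is determined too. *)
Lemma valley_inj i f g : injective f -> injective g -> valley i f -> valley i g ->
  f @: below i = g @: below i -> f =1 g.
Proof.
move=> f_inj g_inj [f0 fl fr] [g0 gl gr] eql.
(* An injective self-map of a finite type is bijective, hence taking images commutes with
   complements. *)
have imC (h : 'I_m.+1 -> 'I_m.+1) : injective h ->
    h @: (~: (i |: below i)) = ~: (h i |: h @: below i).
  move=> h_inj; rewrite -imsetU1; have [k hk kh] := injF_bij h_inj.
  by apply/setP => y; rewrite -(kh y) !inE !(mem_imset _ _ h_inj) !inE.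
have eqr : f @: (~: (i |: below i)) = g @: (~: (i |: below i)).
  by rewrite !imC // eql f0 g0.
move=> x; have [xi|xi|/val_inj->] := ltngtP x i; last by rewrite f0 g0.
- apply: (@eq_in_sorted_image (fun a b => b < a) _ _ _ _ _ _ _ eql); rewrite ?inE //.
  + by move=> y z t yz ty; apply: ltn_trans ty yz.
  + by move=> y; rewrite ltnn.
  + by move=> a b; rewrite !inE => ai bi ab; apply: fl.
  + by move=> a b; rewrite !inE => ai bi ab; apply: gl.
- have above a : a \in ~: (i |: below i) -> i < a.
    by rewrite !inE -val_eqE /=; lia.
  apply: (@eq_in_sorted_image (fun a b => a < b) _ _ _ _ _ _ _ eqr).
  + by move=> y z t; apply: ltn_trans.
  + by move=> y; rewrite ltnn.
  + by move=> a b /above ai _; apply: fr.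
  + by move=> a b /above ai _; apply: gr.
  + by rewrite !inE -val_eqE /=; lia.
Qed.

(* The values in [A] are placed decreasingly to the left of [i], the other
   nonzero values increasingly to its right. *)
Lemma valley_of_set i A : A \subset [set~ ord0] -> #|A| = i ->
  exists f, [/\ injective f, valley i f & f @: below i = A].
Proof.
(* Position [k] of [s] holds the value at [k]; 0 lands at position [i] because [#|A| = i]. *)
move=> A0 cA; pose B := ~: (ord0 |: A); pose s := rev (enum A) ++ ord0 :: enum B.
have A'0 : ord0 \notin A by apply/negP => /(subsetP A0); rewrite !inE.
have sA : size (rev (enum A)) = i by rewrite size_rev -cardE.
have s_uniq : uniq s.
  rewrite cat_uniq rev_uniq enum_uniq /= enum_uniq mem_rev !mem_enum (negbTE A'0).
  rewrite !inE eqxx /= andbT; apply/hasPn => x.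
  by rewrite mem_rev !mem_enum !inE => /norP[].
have s_all x : x \in s.
  by rewrite mem_cat inE mem_rev !mem_enum !inE; case: (x \in A); case: eqP.
have s_size : size s = m.+1.
  rewrite -(card_uniqP s_uniq) -[RHS]card_ord; apply: eq_card => x.
  by rewrite s_all.
have sB : size (enum B) = m - i.
  by move: s_size; rewrite size_cat sA /=; lia.
have nthA k : k < i -> nth ord0 s k = nth ord0 (enum A) (i - k.+1).
  by move=> ki; rewrite nth_cat sA ki nth_rev -?cardE cA.
have nthB k : i < k -> nth ord0 s k = nth ord0 (enum B) (k - i.+1).
  move=> ik; rewrite nth_cat sA ltnNge (ltnW ik) subnS /=.
  (* [k - i] is positive, so the index falls past the head [ord0]. *)
  by case: (k - i) (subn_gt0 i k) => [|j]; rewrite ik.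
have lt_tr : transitive (fun a b : 'I_m.+1 => a < b).
  by move=> x y z; apply: ltn_trans.
have nth_lt (C : {set 'I_m.+1}) j k :
    j < k -> k < size (enum C) -> nth ord0 (enum C) j < nth ord0 (enum C) k.
  move=> jk kC; have := sorted_ltn_nth lt_tr ord0 (sorted_enum_ord C).
  by move/(_ j k); rewrite !inE (ltn_trans jk) // kC; apply.
exists (fun x => nth ord0 s x); split.
- by move=> x y /eqP; rewrite nth_uniq ?s_size // => /eqP/val_inj.
- split; first by rewrite nth_cat sA ltnn subnn.
  + move=> a b ab bi; rewrite !nthA ?(ltn_trans ab bi) //.
    by apply: nth_lt; rewrite -?cardE ?cA; lia.
  + move=> a b ib ba; rewrite !nthB ?(ltn_trans ib ba) //.
    by apply: nth_lt; rewrite ?sB; have := ltn_ord a; lia.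
- apply/setP => y; apply/imsetP/idP => [[x] | yA].
    rewrite inE => xi ->; rewrite nthA // -mem_enum mem_nth // -cardE cA; lia.
  have yr : y \in rev (enum A) by rewrite mem_rev mem_enum.
  have ki : index y (rev (enum A)) < i by rewrite -sA index_mem.
  exists (Ordinal (ltn_trans ki (ltn_ord i))); first by rewrite inE.
  by rewrite /= nth_cat sA ki nth_index.
Qed.

(** Sending [R] to its set of ranks left of [i] is a bijection onto the [i]-subsets of the nonzero
    ranks: [valley_inj] gives injectivity, [valley_of_set] with [ex_linord_rank] surjectivity. *)
Lemma card_admissible i : #|admissible i| = 'C(m, i).
Proof.
have m0 : #|[set~ (ord0 : 'I_m.+1)]| = m by rewrite cardsC1 card_ord.
rewrite -[X in 'C(X, _)]m0 -cards_draws.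
rewrite -(card_in_imset (f := fun R => rank R @: below i)).
  apply: eq_card => A; rewrite [RHS]inE.
  apply/imsetP/andP => [[R] | [A0 /eqP cA]].
    move=> /admissibleP[r0 _ _] ->; split; last first.
      by rewrite card_imset ?card_ord_lt //; apply: rank_inj.
    (* Rank 0 is taken by [i], which does not lie left of itself. *)
    apply/subsetP => y /imsetP[x]; rewrite !inE => xi ->; rewrite -r0.
    by rewrite (inj_eq (@rank_inj R)) -val_eqE neq_ltn xi.
  have [f [f_inj [f0 fl fr] fA]] := valley_of_set A0 cA.
  have [R Rf] := ex_linord_rank f_inj.
  exists R; last by rewrite -fA; apply: eq_imset => x; rewrite Rf.
  by apply/admissibleP; split=> [|a b|a b]; rewrite !Rf; auto.
move=> R1 R2 /admissibleP v1 /admissibleP v2 eqA.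
have eqr := valley_inj (@rank_inj R1) (@rank_inj R2) v1 v2 eqA.
by apply: eq_linord => a b; rewrite -!rank_lt !eqr.
Qed.

End Ranks.

Theorem theorem2 (n : nat) (hn : 2 <= n) :
  #|[set P : profile n |
      narcissistic P && single_peaked_profile (natural_order n) P]|
  = \prod_(2 <= i < n) 'C(n - 1, i - 1).
Proof.
case: n hn => [//|[//|n]] _.
transitivity (\prod_(i < n.+2) 'C(n.+1, i)).
  rewrite -(eq_bigr _ (fun i _ => card_admissible i)) -card_tuple_family.
  apply: eq_card => P; rewrite !inE.
  apply/andP/forallP => [[/forallP nP /forallP sP] i | aP].
    by rewrite inE nP sP.
  by split; apply/forallP => i; have := aP i; rewrite inE => /andP[].
(* The two extreme voters have one admissible order each, so their factors are 1. The other indices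
   are then shifted to start from 0 on both sides. *)
rewrite big_ord_recr big_ord_recl /= bin0 binn mul1n muln1.
rewrite big_add1 big_add1 /= big_mkord; apply: eq_bigr => i _.
by rewrite !subn1.
Qed.
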